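(* Let $C,D$ be at most countable sets, let $u\in\Delta(K\times C\times D)$ exhibit $\varepsilon$-knowledge of the state, and let $v\in\Delta(K\times K_C\times K_D)$, where $K_C=K_D=K$, be such that $\mathrm{marg}_Kv=\mathrm{marg}_Ku$ and $v(k=k_C=k_D)=1$. Then $$d(u,v)\le 20\,\varepsilon.$$
   Context: $K$ is a finite set with $|K|\ge2$. An information structure is a probability on $K\times S_1\times S_2$ with $S_1,S_2$ at most countable, where $k\in K$ is the state and $S_i$ is the set of signals of player $i$. (So $v$ is the structure in which the state is common knowledge and there is no other information.) $\mathrm{marg}_K$ is the marginal on $K$. $u\in\Delta(K\times C\times D)$ exhibits $\varepsilon$-knowledge of the state if there is a mapping $\kappa:C\cup D\to K$ ($C$ and $D$ regarded as disjoint sets) such that $$u\Bigl(\bigl\{u(\{k=\kappa(c)\}\,|\,c)\ge1-\varepsilon\bigr\}\Bigr)\ge1-\varepsilon\quad\text{and}\quad u\Bigl(\bigl\{u(\{k=\kappa(d)\}\,|\,d)\ge1-\varepsilon\bigr\}\Bigr)\ge1-\varepsilon.$$ A payoff function is a map $g:K\times I\times J\to[-1,1]$ with $I,J$ nonempty finite sets; $\mathcal{G}$ is the set of all payoff functions. In the zero-sum Bayesian game $\Gamma(u,g)$, $(k,s_1,s_2)$ is drawn from $u$, player $i$ learns $s_i$, they simultaneously choose $i\in I$ and $j\in J$, and player 1 (the maximizer) receives $g(k,i,j)$ from player 2; $\mathrm{val}(u,g)$ is its value in mixed strategies. The value-based distance is $d(u,v)=\sup_{g\in\mathcal{G}}|\mathrm{val}(u,g)-\mathrm{val}(v,g)|$.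 *)

(* Defs.v *)
From HB Require Import structures.
From mathcomp Require Import all_boot all_order all_algebra.
From mathcomp Require Import all_classical all_reals all_analysis.

Set Implicit Arguments.
Unset Strict Implicit.
Unset Printing Implicit Defensive.

Import Order.TTheory GRing.Theory Num.Theory.

Local Open Scope classical_set_scope.
Local Open Scope ring_scope.

(* Delta(T): every subset of an at most countable T is an event, so a
   probability is given by its mass function. *)
Record dist (R : realType) (T : countType) := Dist {
  mass :> T -> R;
  mass_ge0 : forall t, 0 <= mass t;
  mass_sum1 : \esum_(t in [set: T]) (mass t)%:E = 1%E
}.

Section Dist.
Variables (R : realType) (T : countType).
Implicit Types (u : dist R T) (A B : set T).

Definition Pr u A : R := fine (\esum_(t in A) (u t)%:E).

(* With x / 0 = 0, this is 0 when Pr u B = 0. *)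
Definition cond_Pr u A B : R := Pr u (A `&` B) / Pr u B.

(* \esum is meant for nonnegative families: a signed family is summed as the
   difference of the sums of its positive and negative parts. *)
Definition expect u (f : T -> R) : R :=
  fine (\esum_(t in [set: T]) (Num.max (u t * f t) 0)%:E)
  - fine (\esum_(t in [set: T]) (Num.max (- (u t * f t)) 0)%:E).

End Dist.

(* Information structures are u : dist R (K * S1 * S2), and x : K * S1 * S2
   has state x.1.1 and signals x.1.2, x.2. *)

Definition marg_state (R : realType) (K : finType) (S1 S2 : countType)
    (u : dist R (K * S1 * S2)%type) (k : K) : R :=
  Pr u [set x | x.1.1 = k].

(* The values of cond_Pr at signals of probability 0 change the two sets of x
   below only by a null set. *)
Definition knows_state (R : realType) (K : finType) (C D : countType)
    (eps : R) (u : dist R (K * C * D)%type) : Prop :=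
  exists kappa : C + D -> K,
    Pr u [set x | 1 - eps <= cond_Pr u [set y | y.1.1 = kappa (inl x.1.2)]
                                       [set y | y.1.2 = x.1.2]]
      >= 1 - eps
    /\
    Pr u [set x | 1 - eps <= cond_Pr u [set y | y.1.1 = kappa (inr x.2)]
                                       [set y | y.2 = x.2]]
      >= 1 - eps.

Section BayesianGame.
Variables (R : realType) (K : finType) (S1 S2 : countType) (I J : finType).
Variables (u : dist R (K * S1 * S2)%type) (g : K -> I -> J -> R).

Definition payoff (sigma : S1 -> dist R I) (tau : S2 -> dist R J) : R :=
  expect u (fun x =>
    \sum_(i : I) \sum_(j : J) sigma x.1.2 i * tau x.2 j * g x.1.1 i j).

Definition maxmin : R :=
  sup [set inf [set payoff sigma tau | tau in [set: S2 -> dist R J]]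
      | sigma in [set: S1 -> dist R I]].

Definition minmax : R :=
  inf [set sup [set payoff sigma tau | sigma in [set: S1 -> dist R I]]
      | tau in [set: S2 -> dist R J]].

(* The default 0 is never used for a bounded g on nonempty action sets, by
   the minimax theorem. *)
Definition game_val : R := xget 0 [set w | maxmin = w /\ minmax = w].

End BayesianGame.

Definition payoff_function (R : realType) (K I J : finType)
    (g : K -> I -> J -> R) : Prop :=
  [/\ (0 < #|I|)%N, (0 < #|J|)%N & forall k i j, -1 <= g k i j <= 1].

Definition value_dist (R : realType) (K : finType) (C D C' D' : countType)
    (u : dist R (K * C * D)%type) (v : dist R (K * C' * D')%type) : \bar R :=
  ereal_sup [set r | exists (I J : finType) (g : K -> I -> J -> R),
    payoff_function g /\ r = `|game_val u g - game_val v g|%:E].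

(* Main.v *)
Require Import Defs.
From HB Require Import structures.
From mathcomp Require Import all_boot all_order all_algebra.
From mathcomp Require Import all_classical all_reals all_analysis.
From mathcomp Require Import ring lra.


Set Implicit Arguments.
Unset Strict Implicit.
Unset Printing Implicit Defensive.

Import Order.TTheory GRing.Theory Num.Theory.

Local Open Scope classical_set_scope.
Local Open Scope ring_scope.

(** The proof gives the bound 4 eps. A player who reads the state off
    his signal through [kappa] is wrong with probability at most 2 eps
    ([prob_misread_le]): bad signals have probability at most eps, and at the others
    the conditional probability of an error is at most eps. If player 1 takes a
    strategy of the game in which the state is common knowledge and plays it as
    if [kappa c] were the state, then he keeps its guarantee up to 2 (the range
    of the payoffs) times 2 eps, because an opponent who knows the state and
    holds no other relevant information can do no better than the pure best
    reply state by state, and the two structures have the same law of the state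
    ([maxmin_compare]). The same holds for player 2 ([minmax_compare]). So
    [maxmin u >= maxmin v - 4 eps] and [minmax u <= minmax v + 4 eps].

    To conclude from these two inequalities one needs that both games have a
    value, that is [maxmin = minmax] ([minimax]), although the sets of signals
    may be infinite. No compactness is used. The game is played repeatedly:
    player 1 plays by regret matching at each of his signals separately, and
    player 2 uses a nearly best reply to the strategy that results. By
    orthogonality ([regret_matching], [regret_step]) the squared regrets at a
    signal grow linearly in the number of stages, with a constant proportional
    to the squared probability of the signal. Hence the average regret tends to
    0 uniformly over signals, and the average of player 2's strategies holds
    player 1 down to [maxmin] up to an arbitrarily small error.

    Both arguments pass from single signals to the whole game through
    [expect_le0_fibers], which rests on the linearity of the expectation of
    bounded functions and on the fact that a probability on a countable set is
    almost carried by a finite set. *)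

(** * Expectation as a positive linear functional *)

Section EsumScale.
Variables (R : realType) (T : countType).

Lemma esum_scale_le (c : R) (a : T -> R) : 0 <= c ->
  (\esum_(t in [set: T]) (c * a t)%:E <=
   c%:E * \esum_(t in [set: T]) (a t)%:E)%E.
Proof.
move=> c0; apply: ge_ereal_sup => _ [X [finX XT] <-].
rewrite (_ : (\sum_(x \in X) _)%E = (c%:E * \sum_(x \in X) (a x)%:E)%E).
  by apply: lee_wpmul2l => //; apply: ereal_sup_ubound; exists X.
by rewrite !fsbig_finite//= !sumEFin -EFinM mulr_sumr.
Qed.

Lemma esum_scale (c : R) (a : T -> R) : 0 <= c -> (forall t, 0 <= a t) ->
  (\esum_(t in [set: T]) (c * a t)%:E =
   c%:E * \esum_(t in [set: T]) (a t)%:E)%E.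
Proof.
move=> c0 a0; apply/eqP; rewrite eq_le esum_scale_le//=.
move: c0; rewrite [0 <= c]le_eqVlt => /orP[/eqP<-|c0].
  by rewrite mul0e esum_ge0// => t _; rewrite mul0r.
rewrite -lee_pdivlMl//.
have ci0 : 0 <= c^-1 by rewrite invr_ge0 ltW.
apply: le_trans (esum_scale_le (fun t => c * a t) ci0).
by apply: le_esum => t _; rewrite mulKf ?gt_eqF.
Qed.

End EsumScale.

Section Expectation.
Variables (R : realType) (T : countType) (u : dist R T).
Implicit Types (f g : T -> R).

(** A uniform bound, rather than integrability, is what every payoff and every
    indicator satisfies, and it is stable under products as well as sums. *)
Definition bnd f : Prop := exists M, forall x, `|f x| <= M.

Lemma bnd_cst c : bnd (fun=> c).
Proof. by exists `|c|. Qed.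

Lemma bndD f g : bnd f -> bnd g -> bnd (fun x => f x + g x).
Proof.
move=> [M fM] [N gN]; exists (M + N) => x.
by rewrite (le_trans (ler_normD _ _))// lerD.
Qed.

Lemma bndN f : bnd f -> bnd (fun x => - f x).
Proof. by move=> [M fM]; exists M => x; rewrite normrN. Qed.

Lemma bndM f g : bnd f -> bnd g -> bnd (fun x => f x * g x).
Proof. by move=> [M fM] [N gN]; exists (M * N) => x; rewrite normrM ler_pM. Qed.

Lemma bnd_nat (b : T -> bool) : bnd (fun x => (b x)%:R).
Proof. by exists 1 => x; rewrite normr_nat; case: (b x). Qed.

Lemma bnd_sum (I : Type) (r : seq I) (P : pred I) (F : I -> T -> R) :
  (forall i, P i -> bnd (F i)) -> bnd (fun x => \sum_(i <- r | P i) F i x).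
Proof.
move=> bF; elim: r => [|i r IH].
  by exists 0 => x; rewrite big_nil normr0.
have [M HM] := IH; have [Pi|Pi] := boolP (P i).
  have [N HN] := bF _ Pi; exists (N + M) => x.
  by rewrite big_cons Pi (le_trans (ler_normD _ _))// lerD.
by exists M => x; rewrite big_cons (negbTE Pi).
Qed.

Lemma bnd_maxr f : bnd f -> bnd (fun x => Num.max (f x) 0).
Proof.
move=> [M fM]; exists M => x; apply: le_trans (fM x).
by rewrite /Num.max; case: ifP => // _; rewrite normr0.
Qed.

Let tot (w : T -> R) : R := fine (\esum_(t in [set: T]) (w t)%:E).

Let esum_fin (w : T -> R) : (forall t, 0 <= w t) ->
  (exists M, forall t, w t <= M * u t) ->
  \esum_(t in [set: T]) (w t)%:E \is a fin_num.
Proof.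
move=> w0 [M wM]; rewrite ge0_fin_numE; last by apply: esum_ge0 => t _; exact: w0.
have M0 : 0 <= `|M| by [].
apply: (@le_lt_trans _ _ (\esum_(t in [set: T]) (`|M| * u t)%:E)%E).
  apply: le_esum => t _; rewrite lee_fin (le_trans (wM t))//.
  by rewrite ler_wpM2r ?mass_ge0// ler_norm.
by rewrite esum_scale ?mass_sum1// ?mule1 ?ltry// => t; exact: mass_ge0.
Qed.

Let totD (w w' : T -> R) : (forall t, 0 <= w t) -> (forall t, 0 <= w' t) ->
  (exists M, forall t, w t <= M * u t) -> (exists M, forall t, w' t <= M * u t) ->
  tot (fun t => w t + w' t) = tot w + tot w'.
Proof.
move=> w0 w'0 wM w'M; rewrite /tot -fineD ?esum_fin//; congr fine.
by rewrite -esumD// => t _; rewrite lee_fin.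
Qed.

Let mass_bound f : bnd f -> exists M, forall t, u t * f t <= M * u t.
Proof.
move=> [M HM]; exists M => t; rewrite mulrC ler_wpM2r ?mass_ge0//.
exact: le_trans (ler_norm _) (HM t).
Qed.

Let max_bound f : bnd f -> exists M, forall t, Num.max (u t * f t) 0 <= M * u t.
Proof.
move=> [M fM]; exists M => t.
have M0 : 0 <= M := le_trans (normr_ge0 _) (fM t).
rewrite ge_max mulr_ge0 ?mass_ge0// andbT mulrC ler_wpM2r ?mass_ge0//.
exact: le_trans (ler_norm _) (fM t).
Qed.

(** The expectation does not depend on how the function is cut into a
    difference of nonnegative ones; linearity follows by choosing the cut that
    suits each operation. *)
Lemma expect_split f a b : bnd a -> bnd b ->
  (forall x, 0 <= a x) -> (forall x, 0 <= b x) -> (forall x, f x = a x - b x) ->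
  expect u f = tot (fun x => u x * a x) - tot (fun x => u x * b x).
Proof.
move=> ba bb a0 b0 fE; rewrite /expect -!/(tot _).
have bf : bnd f.
  have [M HM] := bndD ba (bndN bb); exists M => x; rewrite fE; exact: HM.
apply/eqP; rewrite subr_eq addrAC eq_sym subr_eq eq_sym; apply/eqP.
have u0 := @mass_ge0 _ _ u.
have bN : exists M, forall t, Num.max (- (u t * f t)) 0 <= M * u t.
  by have [M HM] := max_bound (bndN bf); exists M => t; rewrite -mulrN.
rewrite -totD//; last 4 first.
- by move=> t; rewrite le_max lexx orbT.
- by move=> t; rewrite mulr_ge0.
- exact: max_bound.
- exact: mass_bound.
rewrite -totD//; last 3 first.
- by move=> t; rewrite mulr_ge0.
- by move=> t; rewrite le_max lexx orbT.
- exact: mass_bound.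
congr tot; apply/funext => x; rewrite /Num.max fE.
by case: ifPn => h1; case: ifPn => h2; lra.
Qed.

Lemma expect_posneg f : bnd f -> expect u f =
  tot (fun x => u x * Num.max (f x) 0) - tot (fun x => u x * Num.max (- f x) 0).
Proof.
move=> bf; apply: expect_split; try exact: bnd_maxr; first exact/bnd_maxr/bndN.
- by move=> x; rewrite le_max lexx orbT.
- by move=> x; rewrite le_max lexx orbT.
- by move=> x; rewrite /Num.max; case: ifPn => h1; case: ifPn => h2; lra.
Qed.

Lemma expect_nonneg f : bnd f -> (forall x, 0 <= f x) ->
  expect u f = tot (fun x => u x * f x).
Proof.
move=> bf f0; rewrite (@expect_split _ f (fun=> 0))//; last 2 first.
- exact: bnd_cst.
- by move=> x; rewrite subr0.
rewrite [X in _ - X](_ : _ = 0) ?subr0//.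
by rewrite /tot esum1// => x _; rewrite mulr0.
Qed.

Lemma expectD f g : bnd f -> bnd g ->
  expect u (fun x => f x + g x) = expect u f + expect u g.
Proof.
move=> bf bg; have m0 (y : R) : 0 <= Num.max y 0 by rewrite le_max lexx orbT.
have u0 := @mass_ge0 _ _ u.
have bou (h : T -> R) (bh : bnd h) := mass_bound (bnd_maxr bh).
rewrite (@expect_split _ (fun x => Num.max (f x) 0 + Num.max (g x) 0)
  (fun x => Num.max (- f x) 0 + Num.max (- g x) 0)).
- under [in X in X - _]eq_fun do rewrite mulrDr.
  under [in X in _ - X]eq_fun do rewrite mulrDr.
  rewrite !totD; try (by move=> t; rewrite mulr_ge0); try (by apply: bou => //; exact: bndN).
  by rewrite !expect_posneg//; lra.
- by apply: bndD; exact: bnd_maxr.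
- by apply: bndD; apply/bnd_maxr/bndN.
- by move=> x; rewrite addr_ge0.
- by move=> x; rewrite addr_ge0.
- move=> x; rewrite /Num.max; do 4 case: ifPn => ?; lra.
Qed.

Lemma expectN f : expect u (fun x => - f x) = - expect u f.
Proof.
rewrite /expect opprB; congr (fine _ - fine _); apply: eq_esum => x _.
  by rewrite mulrN.
by rewrite mulrN opprK.
Qed.

Lemma expectZ c f : bnd f -> expect u (fun x => c * f x) = c * expect u f.
Proof.
have m0 (y : R) : 0 <= Num.max y 0 by rewrite le_max lexx orbT.
have u0 := @mass_ge0 _ _ u.
wlog c0 : c / 0 <= c => [hw bf|bf].
  have [/hw//|/ltW c0] := leP 0 c; first exact.
  have := hw (- c); rewrite oppr_ge0 => /(_ c0 bf).
  under [in X in X -> _]eq_fun do rewrite mulNr.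
  by rewrite expectN mulNr => /oppr_inj.
have totZ (w : T -> R) : (forall t, 0 <= w t) -> (exists M, forall t, w t <= M * u t) ->
    tot (fun x => c * w x) = c * tot w.
  by move=> w0 wM; rewrite /tot esum_scale// fineM ?esum_fin.
have bou (h : T -> R) (bh : bnd h) := mass_bound (bnd_maxr bh).
rewrite (@expect_split _ (fun x => c * Num.max (f x) 0) (fun x => c * Num.max (- f x) 0)).
- under [in X in X - _]eq_fun do rewrite mulrCA.
  under [in X in _ - X]eq_fun do rewrite mulrCA.
  rewrite !totZ; try (by move=> t; rewrite mulr_ge0); try (by apply: bou => //; exact: bndN).
  by rewrite expect_posneg// mulrBr.
- by apply: bndM; [exact: bnd_cst|exact: bnd_maxr].
- by apply: bndM; [exact: bnd_cst|exact/bnd_maxr/bndN].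
- by move=> x; rewrite mulr_ge0.
- by move=> x; rewrite mulr_ge0.
- by move=> x; rewrite -mulrBr; congr (_ * _); rewrite /Num.max; do 2 case: ifPn => ?; lra.
Qed.

Lemma expectB f g : bnd f -> bnd g ->
  expect u (fun x => f x - g x) = expect u f - expect u g.
Proof. by move=> bf bg; rewrite expectD ?expectN//; exact: bndN. Qed.

Lemma expect_cst c : expect u (fun=> c) = c.
Proof.
have -> : (fun=> c) = (fun _ : T => c * 1) by apply/funext => x; rewrite mulr1.
rewrite expectZ ?expect_nonneg//; try exact: bnd_cst.
rewrite /tot; under eq_esum do rewrite mulr1.
by rewrite mass_sum1 mulr1.
Qed.

Lemma expect_sum (I : Type) (r : seq I) (P : pred I) (F : I -> T -> R) :
  (forall i, P i -> bnd (F i)) ->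
  expect u (fun x => \sum_(i <- r | P i) F i x) = \sum_(i <- r | P i) expect u (F i).
Proof.
move=> bF; elim: r => [|i r IH].
  by rewrite big_nil; under eq_fun do rewrite big_nil; rewrite expect_cst.
rewrite big_cons; under eq_fun do rewrite big_cons.
have [Pi|Pi] := boolP (P i); last by rewrite IH.
by rewrite expectD ?IH//; [exact: bF|exact: bnd_sum].
Qed.

Lemma expect_ge0 f : bnd f -> (forall x, 0 <= f x) -> 0 <= expect u f.
Proof.
move=> bf f0; rewrite expect_nonneg// fine_ge0// esum_ge0// => t _.
by rewrite lee_fin mulr_ge0// mass_ge0.
Qed.

Lemma le_expect f g : bnd f -> bnd g -> (forall x, f x <= g x) ->
  expect u f <= expect u g.
Proof.
move=> bf bg fg; rewrite -subr_ge0 -expectB//; apply: expect_ge0.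
  exact/bndD/bndN.
by move=> x; rewrite subr_ge0.
Qed.

Lemma expect_indic (A : set T) : expect u (fun x => (x \in A)%:R) = Pr u A.
Proof.
rewrite expect_nonneg//; last exact: bnd_nat.
rewrite /tot /Pr [in RHS]esum_mkcond; congr fine; apply: eq_esum => x _.
by case: ifP => _; rewrite ?mulr1 ?mulr0.
Qed.

(** Tightness: since the total mass is a supremum of finite sums, almost all of
    it sits on finitely many points. *)
Lemma finite_approx (delta : R) : 0 < delta ->
  exists X : seq T, 1 - delta <= expect u (fun x => (x \in X)%:R).
Proof.
move=> d0.
have : ((1 - delta)%:E < \esum_(t in [set: T]) (u t)%:E)%E.
  by rewrite mass_sum1 lte_fin; lra.
move=> /ereal_sup_gt[_ [_ [/finite_seqP[X ->] _] <-]] lt; exists X.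
have -> : (fun x => (x \in X)%:R : R) = (fun x => (x \in [set` X])%:R).
  by apply/funext => x; rewrite mem_setE.
rewrite expect_indic /Pr esum_fset//; last first.
  by move=> t _; rewrite lee_fin mass_ge0.
move: lt; rewrite !fsbig_finite//=; try exact: finite_seq.
by rewrite sumEFin lte_fin => /ltW.
Qed.

(** A function of nonpositive conditional expectation on every fibre of [pi] has
    nonpositive expectation. By tightness all but a small mass lies on finitely
    many fibres, where finite additivity is enough; so no interchange of
    infinite sums is needed. This is the only passage from statements about
    single signals to statements about the whole game. *)
Lemma expect_le0_fibers (S : eqType) (pi : T -> S) f : bnd f ->
  (forall s, expect u (fun x => (pi x == s)%:R * f x) <= 0) -> expect u f <= 0.
Proof.
move=> bf fib; have [M0 fM0] := bf.
(* adding 1 makes the bound positive, so that e / M makes sense *)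
pose M := `|M0| + 1; have Mgt0 : 0 < M by rewrite /M; have := normr_ge0 M0; lra.
have fM x : `|f x| <= M by rewrite (le_trans (fM0 x))// /M; have := ler_norm M0; lra.
apply/ler_addgt0Pr => e e0; rewrite add0r.
have [X HX] := finite_approx (divr_gt0 e0 Mgt0).
pose F := undup (map pi X).
have sumF x : \sum_(s <- F) (pi x == s)%:R = (pi x \in F)%:R :> R.
  rewrite -natr_sum; congr (_%:R).
  rewrite -(count_uniq_mem _ (undup_uniq _)) -sum1_count -big_mkcond/=.
  by rewrite big_mkcond/= [RHS]big_mkcond/=; apply: eq_bigr => s _; rewrite eq_sym.
have bF s : bnd (fun x => (pi x == s)%:R * f x) by apply: bndM => //; exact: bnd_nat.
have bX (A : pred T) : bnd (fun x => (A x)%:R) by exact: bnd_nat.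
have : expect u f <= expect u (fun x => \sum_(s <- F) (pi x == s)%:R * f x
          + M * (1 - (x \in X)%:R)).
  apply: le_expect => //.
    apply: bndD; first exact: bnd_sum.
    apply: bndM; first exact: bnd_cst.
    by apply: bndD; [exact: bnd_cst|exact/bndN/bX].
  move=> x; rewrite -mulr_suml sumF.
  have := ler_norm (f x); have := fM x.
  have [xX|xX] := boolP (x \in X).
    by rewrite mem_undup map_f//= mulr1n; lra.
  by case: (_ \in F) => /=; rewrite ?mulr1n ?mulr0n; have := ler_norm (- f x); rewrite normrN; lra.
move=> /le_trans; apply.
have b1 : bnd (fun x => 1 - (x \in X)%:R).
  by apply: bndD; [exact: bnd_cst|exact/bndN/bX].
rewrite expectD; [|exact: bnd_sum|by apply: bndM => //; exact: bnd_cst].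
rewrite expect_sum// expectZ// expectB; [|exact: bnd_cst|exact: bX].
rewrite expect_cst.
have : \sum_(s <- F) expect u (fun x => (pi x == s)%:R * f x) <= 0 by exact: sumr_le0.
have : M * (1 - expect u (fun x => (x \in X)%:R)) <= M * (e / M).
  by rewrite ler_pM2l//; lra.
have -> : M * (e / M) = e by rewrite mulrC divfK ?gt_eqF.
lra.
Qed.

End Expectation.

(** * Distributions on finite action sets and regret matching *)

Section FiniteDist.
Variables (R : realType) (I : finType).

Lemma esum_finType (f : I -> R) : (forall i, 0 <= f i) ->
  \esum_(i in [set: I]) (f i)%:E = (\sum_i f i)%:E.
Proof.
move=> f0; rewrite esum_fset; [|exact: finite_finset|by move=> i _; rewrite lee_fin].
have -> : [set: I] = [set` index_enum I].
  by apply/seteqP; split=> // i _ /=; rewrite mem_index_enum.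
by rewrite -fsbig_seq ?index_enum_uniq// sumEFin.
Qed.

Lemma dist_sum1 (p : dist R I) : \sum_i p i = 1.
Proof.
apply: EFin_inj; rewrite -(mass_sum1 p) esum_finType// => i; exact: mass_ge0.
Qed.

Lemma ex_dist (p : I -> R) : (forall i, 0 <= p i) -> \sum_i p i = 1 ->
  exists q : dist R I, q =1 p.
Proof.
by move=> p0 p1; exists (Dist p0 (etrans (esum_finType p0) (congr1 EFin p1))). Qed.

Lemma sum_delta (i0 : I) (a : I -> R) : \sum_i (i == i0)%:R * a i = a i0.
Proof.
by rewrite (bigD1 i0)//= eqxx mul1r big1 ?addr0// => i /negbTE->; rewrite mul0r.
Qed.

Lemma ex_dirac (i0 : I) : exists q : dist R I, q =1 (fun i => (i == i0)%:R).
Proof.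
apply: ex_dist => // .
by have := sum_delta i0 (fun=> 1); under eq_bigr do rewrite mulr1.
Qed.

Lemma dist_avg_le (p : dist R I) (a : I -> R) M :
  (forall i, a i <= M) -> \sum_i p i * a i <= M.
Proof.
move=> aM; rewrite -[M]mul1r -(dist_sum1 p) mulr_suml; apply: ler_sum => i _.
by rewrite ler_wpM2l// mass_ge0.
Qed.

Lemma dist_avg_ge (p : dist R I) (a : I -> R) M :
  (forall i, M <= a i) -> M <= \sum_i p i * a i.
Proof.
move=> aM; rewrite -[M]mul1r -(dist_sum1 p) mulr_suml; apply: ler_sum => i _.
by rewrite ler_wpM2l// mass_ge0.
Qed.

Lemma dist_avg_norm (p : dist R I) (a : I -> R) M :
  (forall i, `|a i| <= M) -> `|\sum_i p i * a i| <= M.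
Proof.
move=> aM; rewrite ler_norml dist_avg_le ?dist_avg_ge// => i.
  by have := aM i; rewrite ler_norml => /andP[].
by rewrite (le_trans (ler_norm _)).
Qed.

Lemma mass_le1 (p : dist R I) i : p i <= 1.
Proof.
rewrite -(dist_sum1 p) (bigD1 i)//= lerDl sumr_ge0// => j _; exact: mass_ge0.
Qed.

(** Playing each action with probability proportional to the positive part of
    its regret makes the vector of regret increments orthogonal to those positive
    parts, whatever the payoffs [q] of the stage turn out to be. *)
Lemma regret_matching (i0 : I) (r : I -> R) : exists p : dist R I,
  forall q : I -> R,
    \sum_i Num.max (r i) 0 * (q i - \sum_j p j * q j) = 0.
Proof.
pose rp i := Num.max (r i) 0; have rp0 i : 0 <= rp i by rewrite /rp le_max lexx orbT.
(* without positive regret the identity is 0 = 0 and any action will do *)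
have [S0|S0] := eqVneq (\sum_i rp i) 0.
  have [p _] := ex_dirac i0; exists p => q; rewrite big1// => i _.
  have /allP/(_ i) : all (fun i => rp i == 0) (index_enum I).
    by rewrite -(@psumr_eq0 _ _ _ xpredT)//; apply/eqP.
  by rewrite mem_index_enum => /(_ isT)/eqP; rewrite /rp => ->; rewrite mul0r.
have [p pE] : exists p : dist R I, p =1 (fun i => rp i / \sum_i rp i).
  apply: ex_dist => [i|]; first by rewrite divr_ge0// sumr_ge0.
  by rewrite -mulr_suml divff.
exists p => q; under eq_bigr do rewrite -/(rp _) mulrBr.
rewrite sumrB -mulr_suml mulr_sumr -sumrB big1// => i _.
by rewrite pE; field.
Qed.

(** Pythagorean step of Blackwell's argument: when the increment is orthogonal
    to the positive part of the regret, the squared length of that positive part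
    grows by at most the squared length of the increment. After [n] stages it is
    of order [n], so the regret itself is of order [sqrt n]. *)
Lemma regret_step (r d : I -> R) (M : R) :
  \sum_i Num.max (r i) 0 * d i = 0 -> (forall i, `|d i| <= M) ->
  \sum_i Num.max (r i + d i) 0 ^+ 2 <=
  \sum_i Num.max (r i) 0 ^+ 2 + #|I|%:R * M ^+ 2.
Proof.
move=> rd dM.
apply: (@le_trans _ _ (\sum_i (Num.max (r i) 0 ^+ 2
                       + 2 * (Num.max (r i) 0 * d i) + d i ^+ 2))).
  apply: ler_sum => i _; rewrite mulr_natl -sqrrD.
  rewrite {1}/Num.max; case: ifPn => h; first by rewrite expr0n/= sqr_ge0.
  have r_le : r i <= Num.max (r i) 0 by rewrite le_max lexx.
  by rewrite ler_sqr ?nnegrE; lra.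
rewrite !big_split/= -mulr_sumr rd mulr0 addr0 lerD2l.
rewrite mulr_natl -sumr_const; apply: ler_sum => i _.
by rewrite -[d i ^+ 2]real_normK ?num_real// ler_sqr ?nnegrE// (le_trans _ (dM i)).
Qed.

End FiniteDist.

(** * Maxmin and minmax of a bounded payoff *)

Section SupInf.
Variables (R : realType) (A B : Type) (P : A -> B -> R) (M : R).
Hypotheses (a0 : A) (b0 : B) (PM : forall a b, `|P a b| <= M).

Let infP a := inf [set P a b | b in [set: B]].
Let supP b := sup [set P a b | a in [set: A]].

Lemma has_inf_reply a : has_inf [set P a b | b in [set: B]].
Proof.
split; first by exists (P a b0); exists b0.
by exists (- M) => _ [b _ <-]; have := PM a b; rewrite ler_norml => /andP[].
Qed.

Lemma has_sup_reply b : has_sup [set P a b | a in [set: A]].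
Proof.
split; first by exists (P a0 b); exists a0.
by exists M => _ [a _ <-]; rewrite (le_trans (ler_norm _)).
Qed.

Let le_infP a b : infP a <= P a b.
Proof. by apply: ge_inf; [exact: (has_inf_reply a).2|exists b]. Qed.

Let le_supP a b : P a b <= supP b.
Proof. by apply: ub_le_sup; [exact: (has_sup_reply b).2|exists a]. Qed.

Lemma has_sup_inf : has_sup [set infP a | a in [set: A]].
Proof.
split; first by exists (infP a0); exists a0.
exists M => _ [a _ <-]; apply: le_trans (le_infP a b0) _.
by rewrite (le_trans (ler_norm _)).
Qed.

Lemma has_inf_sup : has_inf [set supP b | b in [set: B]].
Proof.
split; first by exists (supP b0); exists b0.
exists (- M) => _ [b _ <-]; apply: le_trans _ (le_supP a0 b).
by have := PM a0 b; rewrite ler_norml => /andP[].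
Qed.

Lemma sup_inf_ge a x : (forall b, x <= P a b) ->
  x <= sup [set infP a | a in [set: A]].
Proof.
move=> xP; apply: (@le_trans _ _ (infP a)); last first.
  by apply: ub_le_sup; [exact: has_sup_inf.2|exists a].
by apply: lb_le_inf; [exact: (has_inf_reply a).1|move=> _ [b _ <-]].
Qed.

Lemma inf_sup_le b x : (forall a, P a b <= x) ->
  inf [set supP b | b in [set: B]] <= x.
Proof.
move=> Px; apply: (@le_trans _ _ (supP b)).
  by apply: ge_inf; [exact: has_inf_sup.2|exists b].
by apply: ge_sup; [exact: (has_sup_reply b).1|move=> _ [a _ <-]].
Qed.

Lemma near_best_reply a delta : 0 < delta ->
  exists b, P a b <= sup [set infP a | a in [set: A]] + delta.
Proof.
move=> d0; have [_ [b _ <-] lt] := inf_adherent d0 (has_inf_reply a); exists b.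
apply: le_trans (ltW lt) _; rewrite lerD2r.
by apply: ub_le_sup; [exact: has_sup_inf.2|exists a].
Qed.

Lemma near_sup_inf delta : 0 < delta ->
  exists a, forall b, sup [set infP a | a in [set: A]] - delta <= P a b.
Proof.
move=> d0; have [_ [a _ <-] lt] := sup_adherent d0 has_sup_inf; exists a => b.
exact: le_trans (ltW lt) (le_infP a b).
Qed.

Lemma near_inf_sup delta : 0 < delta ->
  exists b, forall a, P a b <= inf [set supP b | b in [set: B]] + delta.
Proof.
move=> d0; have [_ [b _ <-] lt] := inf_adherent d0 has_inf_sup; exists b => a.
exact: le_trans (le_supP a b) (ltW lt).
Qed.

Lemma sup_inf_le_inf_sup :
  sup [set infP a | a in [set: A]] <= inf [set supP b | b in [set: B]].
Proof.
apply: ge_sup; first exact: has_sup_inf.1.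
move=> _ [a _ <-]; apply: lb_le_inf; first exact: has_inf_sup.1.
by move=> _ [b _ <-]; exact: le_trans (le_infP a b) (le_supP a b).
Qed.

End SupInf.

(** * The minimax theorem for a countable Bayesian game *)

Section Minimax.
Variables (R : realType) (K : finType) (S1 S2 : countType) (I J : finType).
Variables (u : dist R (K * S1 * S2)%type) (g : K -> I -> J -> R).
Hypothesis gP : payoff_function g.

(** [theta] need not be normalised: it will be the sum of the strategies that
    player 2 used in the stages played so far. *)
Definition act_payoff (theta : S2 -> J -> R) (x : K * S1 * S2) (i : I) : R :=
  \sum_j theta x.2 j * g x.1.1 i j.

Lemma payoffE (sigma : S1 -> dist R I) (tau : S2 -> dist R J) :
  payoff u g sigma tau =
  expect u (fun x => \sum_i sigma x.1.2 i * act_payoff tau x i).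
Proof.
congr expect; apply/funext => x; apply: eq_bigr => i _.
by rewrite mulr_sumr; apply: eq_bigr => j _; rewrite mulrA.
Qed.

Lemma g_norm k i j : `|g k i j| <= 1.
Proof. by case: gP => _ _ /(_ k i j); rewrite ler_norml. Qed.

Lemma act_payoff_norm (tau : S2 -> dist R J) x i : `|act_payoff tau x i| <= 1.
Proof. by apply: dist_avg_norm => j; exact: g_norm. Qed.

Lemma stage_norm (sigma : S1 -> dist R I) (tau : S2 -> dist R J) x :
  `|\sum_i sigma x.1.2 i * act_payoff tau x i| <= 1.
Proof. by apply: dist_avg_norm => i; exact: act_payoff_norm. Qed.

Lemma payoff_norm (sigma : S1 -> dist R I) (tau : S2 -> dist R J) :
  `|payoff u g sigma tau| <= 1.
Proof.
have b : bnd (fun x => \sum_i sigma x.1.2 i * act_payoff tau x i).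
  by exists 1 => x; exact: stage_norm.
have lo x : -1 <= \sum_i sigma x.1.2 i * act_payoff tau x i.
  by have := stage_norm sigma tau x; rewrite ler_norml => /andP[].
have hi x : \sum_i sigma x.1.2 i * act_payoff tau x i <= 1.
  by have := stage_norm sigma tau x; rewrite ler_norml => /andP[].
rewrite payoffE ler_norml -{1}(expect_cst u (-1)) -{2}(expect_cst u 1).
by rewrite !le_expect//; exact: bnd_cst.
Qed.

Lemma ex_strategy (S : Type) (A : finType) : (0 < #|A|)%N ->
  exists s : S -> dist R A, True.
Proof. by case/card_gt0P => a _; have [p _] := ex_dirac R a; exists (fun=> p). Qed.

Lemma bnd_act_payoff (theta : S2 -> J -> R) (M : R) i :
  (forall s j, `|theta s j| <= M) -> bnd (fun x => act_payoff theta x i).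
Proof.
move=> tM; apply: bnd_sum => j _; apply: bndM.
  by exists M => x; exact: tM.
by exists 1 => x; exact: g_norm.
Qed.

Lemma sum1_norm (theta : S2 -> J -> R) (M : R) : (forall s j, 0 <= theta s j) ->
  (forall s, \sum_j theta s j = M) -> forall s j, `|theta s j| <= M.
Proof.
move=> t0 tM s j; rewrite ger0_norm// -(tM s) (bigD1 j)//= lerDl.
by apply: sumr_ge0.
Qed.

(* Unnormalised conditional expectation: dividing by the probability of the
   signal would exclude signals of probability 0 and gain nothing, since regrets
   scale with that probability. *)
Let at_signal (s : S1) (f : K * S1 * S2 -> R) : R :=
  expect u (fun x => (x.1.2 == s)%:R * f x).

Let w s := at_signal s (fun=> 1).

Let bsig s (f : K * S1 * S2 -> R) : bnd f -> bnd (fun x => (x.1.2 == s)%:R * f x).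
Proof. by move=> bf; apply: bndM => //; exact: bnd_nat. Qed.

Let at_signalD s f f' : bnd f -> bnd f' ->
  at_signal s (fun x => f x + f' x) = at_signal s f + at_signal s f'.
Proof.
move=> bf bf'; rewrite -expectD; try exact: bsig.
by congr expect; apply/funext => x; rewrite mulrDr.
Qed.

Let at_signalN s f : at_signal s (fun x => - f x) = - at_signal s f.
Proof.
by rewrite -expectN; congr expect; apply/funext => x; rewrite mulrN.
Qed.

Let at_signalB s f f' : bnd f -> bnd f' ->
  at_signal s (fun x => f x - f' x) = at_signal s f - at_signal s f'.
Proof. by move=> bf bf'; rewrite at_signalD ?at_signalN//; exact: bndN. Qed.

Let at_signal_avg s (sigma : S1 -> dist R I) (F : I -> K * S1 * S2 -> R) :
  (forall i, bnd (F i)) ->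
  at_signal s (fun x => \sum_i sigma x.1.2 i * F i x) =
  \sum_i sigma s i * at_signal s (F i).
Proof.
move=> bF; rewrite /at_signal.
under [RHS]eq_bigr => i _ do rewrite -(expectZ _ _ (bsig s (bF i))).
rewrite -expect_sum; last by move=> i _; apply: bndM; [exact: bnd_cst|exact: bsig].
congr expect; apply/funext => x; rewrite mulr_sumr; apply: eq_bigr => i _.
by case: eqP => [->|_]; rewrite ?mul1r ?mul0r ?mulr0.
Qed.

Let at_signal_norm s f : (forall x, `|f x| <= 1) -> `|at_signal s f| <= w s.
Proof.
move=> f1; have bf : bnd f by exists 1.
have b1 : bnd (fun=> 1 : R) := bnd_cst _ _.
rewrite ler_norml -at_signalN; apply/andP; split; apply: le_expect;
  try (by apply: bsig => //; exact: bndN);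
  by move=> x; rewrite ler_wpM2l//; have := f1 x; rewrite ler_norml => /andP[].
Qed.

Let w_ge0 s : 0 <= w s.
Proof. by apply: expect_ge0; [exact/bsig/bnd_cst|move=> x; rewrite mulr1]. Qed.

(** State of the repeated play after [n] stages. At each signal separately,
    player 1 plays by regret matching, and player 2 answers the resulting
    strategy by a reply that yields at most [c]. Here [theta] is the sum of
    player 2's strategies and [b] the sum of the stage payoffs, so that
    [at_signal s (fun x => act_payoff theta x i - b x)] is the regret of player 1
    at [s] for not having always played [i]. *)
Lemma regret_play (c : R) :
  (forall sigma, exists tau, payoff u g sigma tau <= c) ->
  forall n, exists theta : S2 -> J -> R, exists b,
  [/\ forall s j, 0 <= theta s j, forall s, \sum_j theta s j = n%:R, bnd b,
     expect u b <= n%:R * c &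
     forall s, \sum_i Num.max (at_signal s (fun x => act_payoff theta x i - b x)) 0 ^+ 2
        <= n%:R * (#|I|%:R * (2 * w s) ^+ 2)].
Proof.
move=> Hc; have [I0 J0 _] := gP; have /card_gt0P[i0 _] := I0.
elim=> [|n [theta [b [t0 tn bb Eb Hr]]]].
  exists (fun _ _ => 0), (fun=> 0); split=> //.
  - by move=> s; rewrite big1.
  - exact: bnd_cst.
  - by rewrite expect_cst mul0r.
  - move=> s; rewrite mul0r big1// => i _.
    rewrite (_ : at_signal _ _ = 0) ?maxxx ?expr0n//.
    rewrite /at_signal -[RHS](expect_cst u 0); congr expect; apply/funext => x.
    by rewrite /act_payoff big1 ?subr0 ?mulr0// => j _; rewrite mul0r.
pose r s i := at_signal s (fun x => act_payoff theta x i - b x).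
have [sigma Hs] := choice (fun s => regret_matching i0 (r s)).
have [tau Ht] := Hc sigma.
pose pay x := \sum_i sigma x.1.2 i * act_payoff tau x i.
have bpay : bnd pay by exists 1 => x; exact: stage_norm.
have bth i : bnd (fun x => act_payoff theta x i) by apply: bnd_act_payoff; exact: sum1_norm.
have bta i : bnd (fun x => act_payoff tau x i) by exists 1 => x; exact: act_payoff_norm.
exists (fun s j => theta s j + tau s j), (fun x => b x + pay x); split.
- by move=> s j; rewrite addr_ge0// mass_ge0.
- by move=> s; rewrite big_split/= tn dist_sum1 natr1.
- exact: bndD.
- rewrite expectD// -natr1 mulrDl mul1r lerD//.
  by rewrite /pay -payoffE.
move=> s.
pose q i := at_signal s (fun x => act_payoff tau x i).
pose d i := q i - \sum_j sigma s j * q j.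
have rE i : at_signal s (fun x => act_payoff (fun s j => theta s j + tau s j) x i
              - (b x + pay x)) = r s i + d i.
  rewrite /r /d /q -at_signal_avg// -at_signalB// -at_signalD//; last 2 first.
  - exact/bndD/bndN.
  - exact/bndD/bndN.
  congr (at_signal s _); apply/funext => x; rewrite -/(pay x).
  have -> : act_payoff (fun s j => theta s j + tau s j) x i = act_payoff theta x i + act_payoff tau x i.
    by rewrite /act_payoff -big_split/=; apply: eq_bigr => j _; rewrite mulrDl.
  by ring.
under eq_bigr do rewrite rE.
apply: le_trans (regret_step (M := 2 * w s) (Hs s q) _) _.
  move=> i; rewrite /d.
  have q1 j : `|q j| <= w s by apply: at_signal_norm => x; exact: act_payoff_norm.
  have := ler_normB (q i) (\sum_j sigma s j * q j).
  have := @dist_avg_norm _ _ (sigma s) q _ q1; have := q1 i; lra.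
by rewrite -(natr1 n) [leRHS]mulrDl [1 * (_ * _)]mul1r lerD2r; exact: Hr.
Qed.

(** Let player 2 play the average of the replies of [regret_play] after
    [m * m] stages. A strategy of player 1 earns against it at most the average
    stage payoff, which is at most [maxmin] plus [delta], plus the average regret,
    which is at most [2 * #|I| / m]. *)
Lemma minmax_le_maxmin : minmax u g <= maxmin u g.
Proof.
have [I0 J0 _] := gP.
have [sigma0 _] := ex_strategy S1 I0; have [tau0 _] := ex_strategy S2 J0.
have /card_gt0P[i0 _] := I0.
apply/ler_addgt0Pr => e e0; pose delta := e / 2.
have d0 : 0 < delta by rewrite divr_gt0.
(* bounding [#|I|] by its square below avoids a square root *)
pose q : R := #|I|%:R.
have q1 : 1 <= q by rewrite ler1n.
(* the average regret 2 * q / m after m * m stages is at most delta *)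
pose m := (Num.truncn (2 * q / delta)).+1.
have m0 : 0 < m%:R :> R by rewrite ltr0n.
have mq : 2 * q <= m%:R * delta.
  by rewrite -ler_pdivrMr// ltW// truncnS_gt// divr_ge0 ?ltW// mulr_gt0//; lra.
have [theta [b [t0 tn bb Eb Hr]]] :=
  regret_play (fun s => near_best_reply sigma0 tau0 payoff_norm s d0) (m * m).
have /choice[tau tauE] : forall s, exists p : dist R J,
    p =1 (fun j => theta s j / (m * m)%:R).
  move=> s; apply: ex_dist => [j|]; first by rewrite divr_ge0.
  by rewrite -mulr_suml tn divff// pnatr_eq0.
apply: (inf_sup_le sigma0 tau0 payoff_norm (b := tau)) => sigma.
pose avg x := \sum_i sigma x.1.2 i * act_payoff theta x i.
have bth i : bnd (fun x => act_payoff theta x i) by apply: bnd_act_payoff; exact: sum1_norm.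
have bsg i : bnd (fun x : K * S1 * S2 => sigma x.1.2 i).
  by exists 1 => x; rewrite ger0_norm ?mass_ge0// mass_le1.
have bavg : bnd avg by apply: bnd_sum => i _; exact: bndM.
have -> : payoff u g sigma tau = (m * m)%:R^-1 * expect u avg.
  rewrite payoffE -expectZ//; congr expect; apply/funext => x.
  rewrite mulr_sumr; apply: eq_bigr => i _; rewrite mulrCA; congr (_ * _).
  by rewrite mulr_sumr; apply: eq_bigr => j _; rewrite tauE mulrAC mulrC mulrA.
have bc : bnd (fun _ : K * S1 * S2 => 2 * m%:R * q) := bnd_cst _ _.
have reg : expect u (fun x => avg x - b x - 2 * m%:R * q) <= 0.
  have bf : bnd (fun x => avg x - b x) by exact/bndD/bndN.
  (* Signal by signal the average regret of player 1 is at most the largest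
     regret over actions, hence at most 2 * m * q times the mass of the signal. *)
  apply: (@expect_le0_fibers _ _ u S1 (fun x => x.1.2)).
    exact/bndD/bndN.
  move=> s; rewrite -/(at_signal s _) at_signalB//.
  have -> : at_signal s (fun=> 2 * m%:R * q) = 2 * m%:R * q * w s.
    rewrite /w /at_signal -expectZ; last exact/bsig/bnd_cst.
    by congr expect; apply/funext => x; rewrite mulr1 mulrC.
  rewrite subr_le0.
  have -> : (fun x => avg x - b x) =
            (fun x => \sum_i sigma x.1.2 i * (act_payoff theta x i - b x)).
    apply/funext => x; under eq_bigr do rewrite mulrBr.
    by rewrite sumrB -mulr_suml dist_sum1 mul1r.
  rewrite at_signal_avg; last by move=> i; exact/bndD/bndN.
  apply: dist_avg_le => i; set ri := at_signal _ _.
  have w0 := w_ge0 s.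
  have : ri <= Num.max ri 0 by rewrite le_max lexx.
  move=> /le_trans; apply.
  rewrite -ler_sqr ?nnegrE ?le_max ?lexx ?orbT//; last first.
    by rewrite !mulr_ge0// ltW//; lra.
  apply: le_trans (le_trans _ (Hr s)) _.
    rewrite (bigD1 i)//= lerDl sumr_ge0// => j _; exact: sqr_ge0.
  rewrite (_ : (2 * m%:R * q * w s) ^+ 2 = (m * m)%:R * (q * q * (2 * w s) ^+ 2)); last first.
    by rewrite natrM; ring.
  rewrite ler_wpM2l// ler_wpM2r ?sqr_ge0//.
  by rewrite -/q -{1}[q]mulr1 ler_wpM2l//; lra.
rewrite !expectB// in reg; last exact/bndD/bndN.
rewrite expect_cst in reg.
rewrite ler_pdivrMl ?ltr0n//.
have : m%:R * (2 * q) <= m%:R * (m%:R * delta) by rewrite ler_wpM2l// ltW.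
move: Eb reg; rewrite -/(maxmin u g) natrM.
have -> : e = delta + delta by rewrite /delta; lra.
by move=> *; nra.
Qed.

Lemma minimax : maxmin u g = minmax u g.
Proof.
have [I0 J0 _] := gP.
have [sigma0 _] := ex_strategy S1 I0; have [tau0 _] := ex_strategy S2 J0.
apply/eqP; rewrite eq_le minmax_le_maxmin andbT.
exact: (sup_inf_le_inf_sup sigma0 tau0 payoff_norm).
Qed.

Lemma game_valE : game_val u g = maxmin u g.
Proof.
by rewrite /game_val; apply: xget_unique => [|w' [<- _]//]; rewrite /= -minimax.
Qed.

End Minimax.

(** * Comparing the two information structures *)

Lemma Pr_le1 (R : realType) (T : countType) (u : dist R T) A : Pr u A <= 1.
Proof.
rewrite -[leRHS](expect_cst u) -expect_indic; apply: le_expect; first exact: bnd_nat.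
  exact: bnd_cst.
by move=> x; case: (_ \in _).
Qed.

Lemma expect_as (R : realType) (T : countType) (u : dist R T) (A : set T)
    (f f' : T -> R) : bnd f -> bnd f' -> Pr u A = 1 ->
  (forall x, A x -> f x <= f' x) -> expect u f <= expect u f'.
Proof.
move=> bf bf' A1 ff'; have [M HM] := bndD bf (bndN bf').
have bA : bnd (fun x => M * (1 - (x \in A)%:R)).
  apply: bndM; first exact: bnd_cst.
  by apply: bndD; [exact: bnd_cst|exact/bndN/bnd_nat].
have bB : bnd (fun x => 1 - (x \in A)%:R : R).
  by apply: bndD; [exact: bnd_cst|exact/bndN/bnd_nat].
have : expect u f <= expect u (fun x => f' x + M * (1 - (x \in A)%:R)).
  apply: le_expect => //; first exact: bndD.
  move=> x; case: (boolP (x \in A)) => /= [xA|_]; last first.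
    by have := HM x; have := ler_norm (f x - f' x); rewrite mulr0n; lra.
  by rewrite mulr1n subrr mulr0 addr0 ff'//; rewrite inE in xA.
rewrite expectD// expectZ// expectB; [|exact: bnd_cst|exact: bnd_nat].
by rewrite expect_cst expect_indic A1 subrr mulr0 addr0.
Qed.

(** At a good signal the state is misread with conditional probability at most
    [eps], and bad signals have probability at most [eps]. *)
Lemma prob_misread_le (R : realType) (T K : countType) (S : eqType) (u : dist R T)
    (st : T -> K) (sg : T -> S) (kappa : S -> K) (eps : R) :
  1 - eps <= Pr u [set x | 1 - eps <= cond_Pr u [set y | st y = kappa (sg x)]
                                                [set y | sg y = sg x]] ->
  expect u (fun x => (st x != kappa (sg x))%:R) <= 2 * eps.
Proof.
set Good := [set x | _] => hG.
pose good s : bool := 1 - eps <= cond_Pr u [set y | st y = kappa s] [set y | sg y = s].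
have eps0 : 0 <= eps by have := Pr_le1 u Good; lra.
pose wrong x : bool := st x != kappa (sg x).
rewrite -/(wrong _).
have GoodE x : (x \in Good) = good (sg x) by apply/idP/idP; rewrite inE.
rewrite -expect_indic in hG.
have bg : bnd (fun x => (x \in Good)%:R : R) by exact: bnd_nat.
have bw : bnd (fun x => (wrong x)%:R : R) by exact: bnd_nat.
have bwe : bnd (fun x => (wrong x)%:R - eps) by apply: bndD => //; exact: bnd_cst.
have b1 : bnd (fun x => 1 - (x \in Good)%:R : R).
  by apply: bndD; [exact: bnd_cst|exact: bndN].
have be : bnd (fun _ : T => eps) := bnd_cst _ _.
(* at a good signal the error has conditional probability at most eps, and at
   a bad signal the integrand vanishes *)
have key : expect u (fun x => (x \in Good)%:R * ((wrong x)%:R - eps)) <= 0.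
  apply: (@expect_le0_fibers _ _ u S sg); first exact: bndM.
  move=> s.
  have -> : (fun x => (sg x == s)%:R * ((x \in Good)%:R * ((wrong x)%:R - eps))) =
      (fun x => (good s)%:R * ((1 - eps) * (x \in [set y | sg y = s])%:R
        - (x \in [set y | st y = kappa s] `&` [set y | sg y = s])%:R)).
    apply/funext => x; rewrite GoodE in_setI /wrong.
    have -> : (x \in [set y | sg y = s]) = (sg x == s).
      by apply/idP/eqP; rewrite inE.
    have -> : (x \in [set y | st y = kappa s]) = (st x == kappa s).
      by apply/idP/eqP; rewrite inE.
    case: (sg x =P s) => [->|_]; last by rewrite andbF !mulr0 mul0r subrr mulr0.
    by rewrite andbT mul1r; case: (_ == _) => /=; rewrite ?mulr0n ?mulr1n; ring.
  have bI (X : set T) : bnd (fun x => (x \in X)%:R : R) by exact: bnd_nat.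
  have bc (c : R) : bnd (fun _ : T => c) := bnd_cst _ _.
  have bZ (X : set T) : bnd (fun x => (1 - eps) * (x \in X)%:R).
    by apply: bndM; [exact: bc|exact: bI].
  rewrite expectZ; last by apply: bndD; [exact: bZ|exact/bndN/bI].
  rewrite expectB; [|exact: bZ|exact: bI].
  rewrite expectZ; last exact: bI.
  rewrite !expect_indic.
  case: (boolP (good s)) => [|_]; last by rewrite mul0r.
  rewrite mul1r subr_le0 /good /cond_Pr.
  (* q = 0 is the case where cond_Pr is 0 by convention *)
  set p := Pr u (_ `&` _); set q := Pr u _.
  have p0 : 0 <= p by rewrite /p -expect_indic; exact: expect_ge0.
  have : 0 <= q by rewrite /q -expect_indic; exact: expect_ge0.
  rewrite le_eqVlt => /orP[/eqP<-|q0]; first by rewrite mulr0.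
  by rewrite ler_pdivlMr.
have : expect u (fun x => (wrong x)%:R) <=
   expect u (fun x => (1 - (x \in Good)%:R)
      + ((x \in Good)%:R * ((wrong x)%:R - eps) + eps)).
  apply: le_expect => //.
    by apply: bndD => //; apply: bndD => //; exact: bndM.
  by move=> x; case: (_ \in _); case: (wrong x) => /=; rewrite ?mulr0n ?mulr1n; lra.
rewrite expectD//; last by apply: bndD => //; exact: bndM.
rewrite expectB//; last exact: bnd_cst.
rewrite expectD//; last exact: bndM.
by rewrite !expect_cst; lra.
Qed.

Lemma expect_state (R : realType) (K : finType) (S1 S2 : countType)
    (u : dist R (K * S1 * S2)%type) (m : K -> R) :
  expect u (fun x => m x.1.1) = \sum_k m k * marg_state u k.
Proof.
have bI k : bnd (fun x : K * S1 * S2 => (x \in [set y | y.1.1 = k])%:R : R).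
  exact: bnd_nat.
under [RHS]eq_bigr do rewrite /marg_state -expect_indic -expectZ//.
rewrite -expect_sum; last by move=> k _; apply: bndM => //; exact: bnd_cst.
congr expect; apply/funext => x.
rewrite (bigD1 x.1.1)//= big1 => [|k kx].
  by rewrite mem_set// mulr1 addr0.
by rewrite memNset ?mulr0//= => e; rewrite e eqxx in kx.
Qed.

Lemma bnd_fin (R : realType) (T : countType) (K : finType) (st : T -> K) (m : K -> R) :
  bnd (fun x => m (st x)).
Proof.
exists (\sum_k `|m k|) => x.
by rewrite (bigD1 (st x))//= lerDl sumr_ge0.
Qed.

Lemma ex_argmin (R : realType) (J : finType) (F : J -> R) : (0 < #|J|)%N ->
  exists j0, forall j, F j0 <= F j.
Proof.
case/card_gt0P => j1 _.
case: (@arg_minP _ _ _ j1 xpredT F isT) => j0 _ H.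
by exists j0 => j; exact: H.
Qed.

Section Comparison.
Variables (R : realType) (K I J : finType) (C D : countType) (eps : R).
Variables (u : dist R (K * C * D)%type) (v : dist R (K * K * K)%type).
Variable g : K -> I -> J -> R.
Hypothesis gP : payoff_function g.
Hypothesis hmarg : forall k, marg_state v k = marg_state u k.
Hypothesis hv : Pr v [set x | x.1.1 = x.1.2 /\ x.1.1 = x.2] = 1.

(** Player 1 uses a strategy of the game of [v] and treats [kappa c] as if it were
    the state. The best replies of player 2, even if he knew the state, are the
    pure actions [jm k]; these are available to him in the game of [v], so the
    guarantee of that game is lost only where [kappa] misreads the state, and
    there at most the range 2 of the payoffs is lost. *)
Lemma maxmin_compare (kappa : C -> K) :
  expect u (fun x => (x.1.1 != kappa x.1.2)%:R) <= 2 * eps ->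
  maxmin v g - 4 * eps <= maxmin u g.
Proof.
move=> hk; have [I0 J0 _] := gP.
have [sigma0 _] := ex_strategy R C I0; have [tau0 _] := ex_strategy R D J0.
have [sigma1 _] := ex_strategy R K I0; have [tau1 _] := ex_strategy R K J0.
apply/ler_addgt0Pr => delta d0.
have [sigma Hs] := near_sup_inf sigma1 tau1 (payoff_norm v gP) d0.
suff : maxmin v g - 4 * eps - delta <= maxmin u g by lra.
apply: (@sup_inf_ge _ _ _ _ _ sigma0 tau0 (payoff_norm u gP) (sigma \o kappa)) => tau.
pose G k j := \sum_i sigma k i * g k i j.
have [jm Hjm] := choice (fun k => ex_argmin (G k) J0).
have [tau' Ht'] := choice (fun k => ex_dirac R (jm k)).
pose m k := G k (jm k).
have bm (S1 S2 : countType) : bnd (fun x : K * S1 * S2 => m x.1.1) by exact: bnd_fin.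
have E1 : payoff v g sigma tau' <= expect v (fun x => m x.1.1).
  rewrite payoffE; apply: expect_as hv _; first by exists 1 => x; exact: stage_norm.
    exact: bm.
  move=> x [<- e2]; rewrite /m /G; apply: ler_sum => i _.
  rewrite ler_wpM2l ?mass_ge0// /act_payoff; under eq_bigr do rewrite -e2 Ht'.
  by rewrite sum_delta.
have E2 : expect v (fun x => m x.1.1) = expect u (fun x => m x.1.1).
  by rewrite !expect_state; apply: eq_bigr => k _; rewrite hmarg.
have bW : bnd (fun x : K * C * D => (x.1.1 != kappa x.1.2)%:R : R) by exact: bnd_nat.
have bW2 : bnd (fun x : K * C * D => 2 * (x.1.1 != kappa x.1.2)%:R : R).
  by apply: bndM => //; exact: bnd_cst.
have : expect u (fun x => m x.1.1 - 2 * (x.1.1 != kappa x.1.2)%:R)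
    <= payoff u g (sigma \o kappa) tau.
  rewrite payoffE; apply: le_expect.
  - by apply: bndD; [exact: bm|exact: bndN].
  - by exists 1 => x; exact: stage_norm.
  move=> x /=; have [<-|_] := eqVneq x.1.1 (kappa x.1.2); last first.
    have := stage_norm gP (sigma \o kappa) tau x.
    rewrite ler_norml => /andP[+ _].
    have : m x.1.1 <= 1.
      rewrite /m /G; apply: dist_avg_le => i.
      by case: gP => _ _ /(_ x.1.1 i (jm x.1.1))/andP[].
    by rewrite /= mulr1n; lra.
  rewrite mulr0 subr0 /act_payoff.
  under eq_bigr do rewrite mulr_sumr.
  rewrite exchange_big/=.
  rewrite (eq_bigr (fun j => tau x.2 j * G x.1.1 j)).
    by apply: dist_avg_ge => j; exact: Hjm.
  by move=> j _; rewrite /G mulr_sumr; apply: eq_bigr => i _; rewrite mulrCA.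
rewrite expectB//; last exact: bm.
rewrite expectZ// -E2.
have := Hs tau'; rewrite -/(maxmin v g); lra.
Qed.

(** Player 2 treats [kappa d] as if it were the state; the pure best replies of an
    informed player 1 are now the actions [im k], so the reason is that of
    [maxmin_compare] with the inequalities reversed. *)
Lemma minmax_compare (kappa : D -> K) :
  expect u (fun x => (x.1.1 != kappa x.2)%:R) <= 2 * eps ->
  minmax u g <= minmax v g + 4 * eps.
Proof.
move=> hk; have [I0 J0 _] := gP.
have [sigma0 _] := ex_strategy R C I0; have [tau0 _] := ex_strategy R D J0.
have [sigma1 _] := ex_strategy R K I0; have [tau1 _] := ex_strategy R K J0.
apply/ler_addgt0Pr => delta d0.
have [tau Ht] := near_inf_sup sigma1 tau1 (payoff_norm v gP) d0.
apply: (@inf_sup_le _ _ _ _ _ sigma0 tau0 (payoff_norm u gP) (tau \o kappa)) => sigma.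
pose G k i := \sum_j tau k j * g k i j.
have [im Him] := choice (fun k => ex_argmin (fun i => - G k i) I0).
have [sigma' Hs'] := choice (fun k => ex_dirac R (im k)).
pose m k := G k (im k).
have bm (S1 S2 : countType) : bnd (fun x : K * S1 * S2 => m x.1.1) by exact: bnd_fin.
have E1 : expect v (fun x => m x.1.1) <= payoff v g sigma' tau.
  rewrite payoffE; apply: expect_as hv _; first exact: bm.
    by exists 1 => x; exact: stage_norm.
  move=> x [<- e2]; under [leRHS]eq_bigr do rewrite Hs'.
  by rewrite sum_delta /m /G /act_payoff e2.
have E2 : expect v (fun x => m x.1.1) = expect u (fun x => m x.1.1).
  by rewrite !expect_state; apply: eq_bigr => k _; rewrite hmarg.
have bW : bnd (fun x : K * C * D => (x.1.1 != kappa x.2)%:R : R) by exact: bnd_nat.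
have bW2 : bnd (fun x : K * C * D => 2 * (x.1.1 != kappa x.2)%:R : R).
  by apply: bndM => //; exact: bnd_cst.
have : payoff u g sigma (tau \o kappa) <=
    expect u (fun x => m x.1.1 + 2 * (x.1.1 != kappa x.2)%:R).
  rewrite payoffE; apply: le_expect.
  - by exists 1 => x; exact: stage_norm.
  - by apply: bndD; [exact: bm|].
  move=> x /=; have [e|_] := eqVneq x.1.1 (kappa x.2); last first.
    have := stage_norm gP sigma (tau \o kappa) x.
    rewrite ler_norml => /andP[_].
    have : -1 <= m x.1.1.
      rewrite /m /G; apply: dist_avg_ge => j.
      by case: gP => _ _ /(_ x.1.1 (im x.1.1) j)/andP[].
    by rewrite /= mulr1n; lra.
  rewrite mulr0 addr0; apply: dist_avg_le => i; rewrite /act_payoff /= -e.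
  by have := Him x.1.1 i; rewrite lerN2.
rewrite expectD//; last exact: bm.
rewrite expectZ// -E2.
have := Ht sigma'; rewrite -/(minmax v g); lra.
Qed.

End Comparison.

Theorem proposition17 (R : realType) (K : finType) (hK : (1 < #|K|)%N)
    (C D : countType) (eps : R)
    (u : dist R (K * C * D)%type) (hu : knows_state eps u)
    (v : dist R (K * K * K)%type)
    (hmarg : forall k, marg_state v k = marg_state u k)
    (hv : Pr v [set x | x.1.1 = x.1.2 /\ x.1.1 = x.2] = 1) :
  (value_dist u v <= (20 * eps)%:E)%E.
Proof.
have [kappa [h1 h2]] := hu.
have eps0 : 0 <= eps by have := le_trans h1 (Pr_le1 _ _); lra.
have w1 := @prob_misread_le _ _ K C u (fun x => x.1.1) (fun x => x.1.2) (fun c => kappa (inl c)) eps h1.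
have w2 := @prob_misread_le _ _ K D u (fun x => x.1.1) (fun x => x.2) (fun d => kappa (inr d)) eps h2.
apply: ge_ereal_sup => _ [I [J [g [gP ->]]]].
rewrite lee_fin !game_valE// ler_norml.
have := maxmin_compare (kappa := fun c => kappa (inl c)) gP hmarg hv w1.
have := minmax_compare (kappa := fun d => kappa (inr d)) gP hmarg hv w2.
rewrite -!minimax//; lra.
Qed.
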